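(* There is a family $\{Y_\alpha:\alpha<2^{\mathfrak{c}}\}$ of dense countable subspaces $Y_\alpha\subset D^{\mathfrak{c}}$ such that: (1) for every $\alpha<2^{\mathfrak{c}}$, no nontrivial sequence of points of $Y_\alpha$ converges in $D^{\mathfrak{c}}$; and (2) $Y_\alpha$ and $Y_{\alpha'}$ are disjoint and non-homeomorphic whenever $\alpha\neq\alpha'$.
   Context: $\mathfrak{c}=2^{\aleph_0}$. $D=\{0,1\}$ is the two-point discrete space and $D^{\mathfrak{c}}$ carries the product topology. A sequence is called trivial if it is eventually constant, and nontrivial otherwise. Convergence in $D^{\mathfrak{c}}$ means convergence to some point of $D^{\mathfrak{c}}$ (not necessarily in $Y_\alpha$). *)

(* Defs.v *)
From HB Require Import structures.
From mathcomp Require Import all_boot all_order all_algebra.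
From mathcomp Require Import all_classical all_reals all_analysis.

Set Implicit Arguments.
Unset Strict Implicit.
Unset Printing Implicit Defensive.

Local Open Scope classical_set_scope.

(* A type of cardinality c = 2^aleph_0. *)
Definition continuum : Type := nat -> bool.

(* A type of cardinality 2^c; it replaces the ordinals below 2^c as a set of
   labels, their well-order being irrelevant. *)
Definition two_pow_continuum : Type := continuum -> bool.

(* D^c: [prod_topology] is the product topology, and the library's topology on
   [bool] is the discrete one. *)
Definition Dc : topologicalType := prod_topology (fun _ : continuum => bool).

Definition trivial_seq (T : Type) (u : nat -> T) : Prop :=
  exists N : nat, forall n : nat, (N <= n)%N -> u n = u N.

Definition seq_converges (T : topologicalType) (u : nat -> T) : Prop :=
  exists l : T, u @ \oo --> l.

Definition homeomorphic (X Z : topologicalType) : Prop :=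
  exists (f : X -> Z) (g : Z -> X),
    [/\ cancel f g, cancel g f, continuous f & continuous g].

(* Main.v *)
(* Points of a countable set S indexed as [y s] (s in S) correspond to a family
   of subsets A_i = {s | y s i = 1} of S: the points are dense when the family
   is independent, and no nontrivial sequence converges when every infinite
   subset of S is split by some A_i.  Take S = {((n, L), j)} and Hausdorff's
   independent family I_z = {((n, L), j) | z restricted to n lies in L}, z in
   2^omega.  Its boolean combinations contain whole columns (n, L) with n
   arbitrarily large, so it stays independent after changing each I_z on a set
   that meets every column with n large in a finite set.  Every infinite
   subset of S contains an infinite set of that kind, which leaves room for
   splitting.
   For a label a : 2^c use only half of the family: A_i comes from
   I_(a(x), i), with x decoded from i.  By independence the induced topology on
   S recovers a, so each homeomorphism class contains at most c labels, one for
   each self-map of S.  Konig's diagonal argument on (2^c)^c then selects 2^c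
   pairwise nonhomeomorphic spaces.  Finite changes of the A_i make a(x) the
   common limit along countably many coordinates of all points with label a,
   whence disjointness. *)
Require Import Defs.
From mathcomp Require Import all_boot all_order all_algebra.
From mathcomp Require Import all_classical all_reals all_analysis.

Set Implicit Arguments.
Unset Strict Implicit.

Local Open Scope classical_set_scope.

(** * Eventual properties and infinite ranges *)

Lemma eventually_all (T : eqType) (F : seq T) (P : T -> nat -> Prop) :
  (forall x, x \in F -> exists N, forall n, (N <= n)%N -> P x n) ->
  exists N, forall n, (N <= n)%N -> forall x, x \in F -> P x n.
Proof.
elim: F => [|a F IH] h; first by exists 0%N.
have [x xF|N1 h1] := IH; first by apply: h; rewrite inE xF orbT.
have [|N2 h2] := h a; first by rewrite mem_head.
exists (maxn N1 N2) => n; rewrite geq_max => /andP[n1 n2] x.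
by rewrite inE => /orP[/eqP->|xF]; [exact: h2|exact: h1].
Qed.

Lemma injective_unbounded (g : nat -> nat) (m : nat) :
  injective g -> exists N, forall n, (N <= n)%N -> (m < g n)%N.
Proof.
move=> ginj.
have [x _|N h] := @eventually_all _ (iota 0 m.+1) (fun x n => g n <> x).
  have [[k gk]|nk] := pselect (exists k, g k = x); last first.
    by exists 0%N => n _ gn; apply: nk; exists n.
  by exists k.+1 => n kn; rewrite -gk => /ginj nk; rewrite nk ltnn in kn.
exists N => n /h gn; rewrite ltnNge; apply/negP => gm.
by apply: (gn (g n)) => //; rewrite mem_iota.
Qed.

Definition infinite_range (T : Type) (f : nat -> T) :=
  forall N, exists k, forall j, (j < N)%N -> f k <> f j.

Lemma injective_subsequence (T : Type) (f : nat -> T) (P : nat -> Prop) :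
  (forall N, exists k, P k /\ forall j, (j < N)%N -> f k <> f j) ->
  exists t : nat -> nat,
    [/\ {homo t : k l / (k < l)%N}, forall k, P (t k) & injective (f \o t)].
Proof.
move=> /choice[h hP].
have hN N : (N <= h N)%N.
  by rewrite leqNgt; apply/negP => lt; have [_ /(_ _ lt)] := hP N.
pose t k := iter k (fun n => h n.+1) (h 0%N).
have tP k : P (t k) by case: k => [|k]; apply: (hP _).1.
have tinc : {homo t : k l / (k < l)%N}.
  by apply: homo_ltn => [x y z|k]; [exact: ltn_trans|exact: hN].
have tne k l : (k < l)%N -> f (t l) <> f (t k).
  case: l => // l; rewrite ltnS => kl; apply: (hP (t l).+1).2.
  by rewrite ltnS (leq_mono tinc).
exists t; split=> // k l /= e.
by have [kl|lk|//] := ltngtP k l; [case: (tne _ _ kl)|case: (tne _ _ lk)].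
Qed.

(* [((n, L), j)]: the [j]-th site of the column [(n, L)], where [L] stands for a
   set of words of length [n]. *)
Notation site := ((nat * seq (seq bool)) * nat)%type.

Definition prefix_in (z : continuum) (s : site) : bool :=
  mkseq z s.1.1 \in s.1.2.

(** If one column receives infinitely many values, stay in it: columns with larger [n] are then
    missed. Otherwise infinitely many columns are visited, and at most one site is kept in each. *)
Lemma thin_subsequence (w : nat -> site) : infinite_range w ->
  exists t : nat -> nat, [/\ {homo t : k l / (k < l)%N}, injective (w \o t) &
    exists N, forall c, (N <= c.1)%N ->
      exists M, forall j, (M <= j)%N -> forall k, w (t k) <> (c, j)].
Proof.
move=> winf.
have [[c0 hc]|nc] := pselect (exists c, forall N, exists k,
    (w k).1 = c /\ forall j, (j < N)%N -> w k <> w j).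
  have [t [tinc tc tinj]] := injective_subsequence hc.
  exists t; split=> //; exists c0.1.+1 => c lt; exists 0%N => j _ k e.
  by have := tc k; rewrite e /= => cc; rewrite -cc ltnn in lt.
have /choice[B hB] c : exists N, forall k, (w k).1 = c ->
    exists2 j, (j < N)%N & w k = w j.
  apply: contrapT => h; apply: nc; exists c => N; apply: contrapT => h'.
  apply: h; exists N => k wkc; apply: contrapT => h; apply: h'; exists k.
  by split=> // j jN e; apply: h; exists j.
have colinf N : exists k, True /\ forall j, (j < N)%N -> (w k).1 <> (w j).1.
  have [k hk] := winf (\max_(j < N) B (w j).1).
  exists k; split=> // j jN e.
  have [j' j'B] := hB _ _ e; apply: hk.
  exact: leq_trans j'B (leq_bigmax (Ordinal jN)).
have [t [tinc _ tinj]] := injective_subsequence colinf.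
exists t; split=> // [k l /= e|]; first by apply: tinj; rewrite /= e.
exists 0%N => c _; have [[k wk]|nk] := pselect (exists k, (w (t k)).1 = c).
  exists (w (t k)).2.+1 => j lt l e.
  have kl : k = l by apply: tinj; rewrite /= wk e.
  by rewrite kl e ltnn in lt.
by exists 0%N => j _ k e; apply: nk; exists k; rewrite e.
Qed.

(** The prefix set of [z] is altered only on the finitely many sites of number at most [m] and on a
    thin subsequence of [w], where membership alternates. *)
Lemma split_set (z : continuum) (b : bool) (m : nat) (w : nat -> site) :
  exists A : site -> bool,
  [/\ forall s, (pickle s <= m)%N -> A s = b,
      infinite_range w -> forall v N, exists2 k, (N <= k)%N & A (w k) = v
    & exists N, forall c, (N <= c.1)%N ->
        exists M, forall j, (M <= j)%N -> A (c, j) = prefix_in z (c, j)].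
Proof.
have late (c : nat * seq (seq bool)) :
    exists M, forall j, (M <= j)%N -> (m < pickle (c, j))%N.
  have inj : injective (fun j : nat => pickle (c, j)).
    by move=> j j' /(pcan_inj pickleK) [].
  exact: injective_unbounded inj.
have [winf|wfin] := pselect (infinite_range w); last first.
  exists (fun s => if (pickle s <= m)%N then b else prefix_in z s).
  split=> // [s ->//|]; exists 0%N => c _; have [M hM] := late c.
  by exists M => j /hM; rewrite ltnNge => /negbTE ->.
have [t [tinc tinj [N hN]]] := thin_subsequence winf.
exists (fun s => if (pickle s <= m)%N then b else
  if `[< exists k, s = w (t k) >] then `[< exists k, s = w (t k.*2) >]
  else prefix_in z s); split=> [s ->//|_ v K|].
  have inj : injective (fun k => pickle (w (t k))).
    by move=> k l /(pcan_inj pickleK) /tinj.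
  have [L hL] := injective_unbounded m inj.
  (* Even positions of the subsequence lie in [A], odd ones do not; [L] keeps the site number above
     [m]. *)
  set k := (maxn K L).*2 + ~~ v.
  have k2 : (maxn K L <= k)%N by rewrite /k -addnn -addnA leq_addr.
  have tk : (k <= t k)%N.
    elim: (k) => // n IH; apply: leq_ltn_trans IH _; exact: tinc.
  exists (t k).
    by rewrite (leq_trans _ tk) // (leq_trans _ k2) // leq_maxl.
  have := hL k; rewrite (leq_trans _ k2) ?leq_maxr // ltnNge.
  move=> /(_ isT) /negbTE ->; rewrite asboolT; last by exists k.
  case: v @k k2 {tk} => k k2.
    by apply/asboolP; exists (maxn K L); rewrite /k addn0.
  apply/asboolP => -[l /tinj kl]; have := congr1 odd kl.
  by rewrite /k addn1 /= !odd_double.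
exists N => c /hN[M1 hM1]; have [M2 hM2] := late c.
exists (maxn M1 M2) => j; rewrite geq_max => /andP[/hM1 j1 /hM2].
rewrite ltnNge => /negbTE ->; rewrite asboolF // => -[k /esym e].
exact: (j1 k).
Qed.

(** * Independence of the prefix sets *)

Definition cantor_cons (b : bool) (i : continuum) : continuum :=
  fun n => if n is k.+1 then i k else b.

Lemma cantor_cons_inj b b' i i' :
  cantor_cons b i = cantor_cons b' i' -> (b, i) = (b', i').
Proof.
move=> e; have /= -> := congr1 (@^~ 0%N) e; congr pair.
by apply/funext => n; exact: (congr1 (@^~ n.+1) e).
Qed.

Lemma mkseq_eventually_injective (F : seq continuum) :
  exists N, forall n, (N <= n)%N -> {in F &, injective (@mkseq bool ^~ n)}.
Proof.
have [x _|N hN] := @eventually_all _ F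
    (fun x n => forall y, y \in F -> mkseq x n = mkseq y n -> x = y); last first.
  by exists N => n Nn x y xF; exact: hN.
apply: (@eventually_all _ F (fun y n => mkseq x n = mkseq y n -> x = y)) => y _.
have [->|/eqP xy] := eqVneq x y; first by exists 0%N.
have [k hk] : exists k, x k <> y k.
  by apply/existsNP => h; apply: xy; exact/funext.
exists k.+1 => n kn e; case: hk.
by have := congr1 (nth false ^~ k) e; rewrite !nth_mkseq.
Qed.

Lemma independent_mod_small (J : bool -> continuum -> site -> bool) :
  (forall b i, exists N, forall c, (N <= c.1)%N -> exists M, forall j,
    (M <= j)%N -> J b i (c, j) = prefix_in (cantor_cons b i) (c, j)) ->
  forall (F : seq (bool * continuum)) (g : bool * continuum -> bool),
    exists s, forall q, q \in F -> J q.1 q.2 s = g q.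
Proof.
move=> hJ F g; pose z (q : bool * continuum) := cantor_cons q.1 q.2.
have [N1 h1] := mkseq_eventually_injective [seq z q | q <- F].
have [q _|N2 h2] := @eventually_all _ F (fun q n => forall L, exists M, forall j,
    (M <= j)%N -> J q.1 q.2 ((n, L), j) = prefix_in (z q) ((n, L), j)).
  have [N hN] := hJ q.1 q.2; exists N => n Nn L; exact: (hN (n, L)).
(* At this length distinct [z q] have distinct prefixes, so the prefix of [z q] lies in [L] exactly
   when [g q] holds. *)
pose n := maxn N1 N2; pose L := [seq mkseq (z q) n | q <- F & g q].
have [q qF|M hM] := @eventually_all _ F (fun q j =>
    J q.1 q.2 ((n, L), j) = prefix_in (z q) ((n, L), j)).
  exact: h2 (leq_maxr _ _) _ qF L.
exists ((n, L), M) => q qF; rewrite hM // /prefix_in /=.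
apply/mapP/idP => [[q' ]|gq]; last by exists q => //; rewrite mem_filter gq.
rewrite mem_filter => /andP[gq' q'F] e.
have /cantor_cons_inj : z q = z q'.
  by apply: (h1 n (leq_maxl _ _)) => //; exact: map_f.
by case: q q' gq' {qF q'F e} => ? ? [? ?] gq' [-> ->].
Qed.

(** * Construction of the points *)

Lemma continuum_onto (T : countType) (t0 : T) :
  exists d : continuum -> nat -> T, forall w, exists i, d i = w.
Proof.
exists (fun i n => xget t0 [set t | i (pickle (n, t))]) => w.
(* The code of [w] is its graph. *)
exists (fun k => if unpickle k is Some (n, t) then t == w n else false).
apply/funext => n; apply: xget_unique => [|t] /=; rewrite pickleK //.
by move/eqP.
Qed.

(* A coordinate [i] encodes a pair [(p i, m i)] and, in another way, a sequence
   [dw i] to be split.  At [i] the points of number at most [m i] take the value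
   [a (p i)]; since [m] is unbounded on the fibres of [p], each point of the
   family labelled [a] determines [a]. *)
Lemma exists_points : exists y : two_pow_continuum -> site -> Dc,
  [/\ forall a (F : seq continuum) (v : Dc),
        exists s, forall i, i \in F -> y a s i = v i,
      forall a (w : nat -> site), infinite_range w ->
        exists i, forall v N, exists2 k, (N <= k)%N & y a (w k) i = v,
      forall a a' s s', y a s = y a' s' -> a = a'
    & forall a a', a <> a' -> exists i, forall (F : seq continuum) (v : Dc) b,
        exists s, (forall i', i' \in F -> y a' s i' = v i') /\ y a s i = b].
Proof.
have [dw dwP] := @continuum_onto site ((0%N, [::]), 0%N).
have [d dP] := @continuum_onto (nat * bool)%type (0%N, false).
pose m i := (d i 0%N).1; pose p i : continuum := fun n => (d i n).2.
have mp_onto x M : exists i, p i = x /\ m i = M.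
  have [i di] := dP (fun n => (M, x n)); exists i.
  by rewrite /p /m di.
have /choice[J hJ] bi := split_set (cantor_cons bi.1 bi.2) bi.1 (m bi.2) (dw bi.2).
have indep := @independent_mod_small (fun b i => J (b, i)).
have {}indep := indep (fun b i => let: And3 _ _ h := hJ (b, i) in h).
exists (fun a s i => J (a (p i), i) s); split.
- move=> a F v.
  have [s hs] := indep [seq (a (p i), i) | i <- F] (fun q => v q.2).
  by exists s => i iF; have := hs (a (p i), i) (map_f _ iF).
- move=> a w winf; have [i dwi] := dwP w; exists i => v N.
  have [_ + _] := hJ (a (p i), i).
  by rewrite /= dwi => /(_ winf v N) [k]; exists k.
- move=> a a' s s' e; apply/funext => x.
  have [i [pix mi]] := mp_onto x (maxn (pickle s) (pickle s')).
  have [/(_ s) /= Ja _ _] := hJ (a x, i).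
  have [/(_ s') /= Ja' _ _] := hJ (a' x, i).
  have := congr1 (@^~ i) e; rewrite /= pix.
  by rewrite Ja ?Ja' // mi ?leq_maxl ?leq_maxr.
- move=> a a' aa'; have [x ax] : exists x, a x <> a' x.
    by apply/existsNP => h; apply: aa'; exact/funext.
  have [i [pix _]] := mp_onto x 0%N; exists i => F v b.
  have [s hs] := indep ((a (p i), i) :: [seq (a' (p i), i) | i <- F])
    (fun q => if q == (a (p i), i) then b else v q.2).
  exists s; split=> [i' i'F|].
    have /= -> := hs (a' (p i'), i'); last first.
      by rewrite inE map_f ?orbT //.
    by case: eqP => // -[+ i'i]; rewrite i'i pix => /esym.
  by have := hs (a (p i), i); rewrite mem_head eqxx; exact.
Qed.

(** * Neighbourhoods in the product *)

Lemma nbhs_Dc_box (x : Dc) (U : set Dc) : nbhs x U ->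
  exists F : seq continuum, forall y, (forall i, i \in F -> y i = x i) -> U y.
Proof.
(* The filter generated by boxes around [x] converges to [x] in every coordinate, hence contains all
   neighbourhoods of [x]. *)
pose G : set_system Dc := [set U | exists F : seq continuum,
  forall y, (forall i, i \in F -> y i = x i) -> U y].
have GF : Filter G.
  split=> [|A B [F hF] [F' hF']|A B AB [F hF]].
  - by exists [::].
  - exists (F ++ F') => y h; split.
      by apply: hF => i iF; apply: h; rewrite mem_cat iF.
    by apply: hF' => i iF; apply: h; rewrite mem_cat iF orbT.
  - by exists F => y /hF /AB.
have : G --> x.
  apply/cvg_sup => i A [_ [[B _ <-] Bxi BA]].
  by exists [:: i] => y hy; apply: BA; rewrite /= hy // mem_head.
exact.
Qed.

Lemma Dc_nbhs_coordinate (x : Dc) (i : continuum) :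
  nbhs x [set y : Dc | y i = x i].
Proof.
have := @proj_continuous continuum (fun _ => bool) i x.
by move=> /discrete_cvg.
Qed.

(* Otherwise a function [t] with [t xi] outside the [xi]-th projection of the
   [xi]-th fibre of [k] lies in no fibre. *)
Lemma konig (K T : Type) (k : (K -> T) -> K) :
  exists xi, forall a, exists2 g, k g = xi & g xi = a.
Proof.
apply: contrapT => /forallNP h.
have /choice[t ht] xi : exists a, forall g, k g = xi -> g xi <> a.
  have /existsNP[a ha] := h xi; exists a => g kg ga; apply: ha; by exists g.
exact: (ht (k t) t).
Qed.

Lemma homeomorphic_sym X Z : homeomorphic X Z -> homeomorphic Z X.
Proof. by move=> [f [g [? ? ? ?]]]; exists g, f. Qed.

Lemma homeomorphic_trans Y X Z :
  homeomorphic X Y -> homeomorphic Y Z -> homeomorphic X Z.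
Proof.
move=> [f [g [fg gf cf cg]]] [f' [g' [fg' gf' cf' cg']]].
exists (f' \o f), (g \o g'); split.
- exact: can_comp.
- exact: can_comp.
- by move=> x; apply: continuous_comp; [exact: cf|exact: cf'].
- by move=> x; apply: continuous_comp; [exact: cg'|exact: cg].
Qed.

(** * Convergent sequences and density *)

Lemma seq_converges_coordinate (u : nat -> Dc) (l : Dc) (i : continuum) :
  u @ \oo --> l -> exists N, forall n, (N <= n)%N -> u n i = l i.
Proof.
move=> ul; have [N _ hN] := ul _ (Dc_nbhs_coordinate l i).
by exists N => n /hN.
Qed.

(** Each of the finitely many values other than the limit differs from it at some coordinate, so it
    is eventually avoided. *)
Lemma finite_range_trivial (u : nat -> Dc) :
  ~ infinite_range u -> seq_converges u -> trivial_seq u.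
Proof.
move=> fin [l ul].
have {fin}[N hN] : exists N, forall k, exists2 j, (j < N)%N & u k = u j.
  apply: contrapT => h; apply: fin => N; apply: contrapT => h'.
  apply: h; exists N => k; apply: contrapT => h; apply: h'; exists k => j jN e.
  by apply: h; exists j.
have [j _|M hM] := @eventually_all _ (iota 0 N) (fun j n => u n = u j -> u n = l).
  have [<-|jl] := pselect (u j = l); first by exists 0%N.
  have [i ji] : exists i, u j i <> l i.
    by apply/existsNP => h; apply: jl; exact/funext.
  have [M hM] := seq_converges_coordinate i ul.
  by exists M => n /hM Mn e; case: ji; rewrite -e.
have uM n : (M <= n)%N -> u n = l.
  by move=> Mn; have [j jN e] := hN n; apply: (hM n Mn j); rewrite ?mem_iota.
by exists M => n Mn; rewrite !uM.
Qed.

Lemma no_convergent_sequence (y : site -> Dc) :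
  (forall w : nat -> site, infinite_range w ->
    exists i, forall v N, exists2 k, (N <= k)%N & y (w k) i = v) ->
  forall u : nat -> Dc, (forall n, range y (u n)) ->
    ~ trivial_seq u -> ~ seq_converges u.
Proof.
move=> ysplit u yu unt uc; have := uc => -[l ul].
have /choice[w wP] n : exists s, y s = u n by have [s _] := yu n; exists s.
have [i hi] : exists i, forall v N, exists2 k, (N <= k)%N & y (w k) i = v.
  apply: ysplit => N; apply: contrapT => h; apply: unt.
  apply: finite_range_trivial uc => /(_ N)[k hk]; apply: h.
  by exists k => j /hk + e; rewrite -!wP e.
have [N hN] := seq_converges_coordinate i ul.
by have [k /hN + e] := hi (~~ l i) N; rewrite -wP e; case: (l i).
Qed.

Lemma dense_range (y : site -> Dc) :
  (forall (F : seq continuum) (v : Dc),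
    exists s, forall i, i \in F -> y s i = v i) -> dense (range y).
Proof.
move=> yd O [x Ox] Oo.
have [F hF] := nbhs_Dc_box (open_nbhs_nbhs (conj Oo Ox)).
by have [s /hF] := yd F x; exists (y s); split=> //; exists s.
Qed.

(** * Selection of nonhomeomorphic spaces *)

(** For distinct labels, continuity would make coordinate [i] of [g x] locally constant, hence fixed
    by finitely many coordinates of [x], of which it is independent. *)
Lemma relabelling_continuous_eq (y : two_pow_continuum -> site -> Dc) :
  (forall a a', a <> a' -> exists i, forall (F : seq continuum) (v : Dc) b,
    exists s, (forall i', i' \in F -> y a' s i' = v i') /\ y a s i = b) ->
  forall a a' (g : set_type (range (y a')) -> set_type (range (y a))),
    continuous g -> (forall x s, val x = y a' s -> val (g x) = y a s) ->
    a = a'.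
Proof.
move=> ytop a a' g gc gy; apply: contrapT => /ytop[i hi].
have pt s : {x : set_type (range (y a')) | val x = y a' s}.
  by exists (SigSub (mem_set (imageT (y a') s))).
pose s0 : site := ((0%N, [::]), 0%N); have [x0 x0E] := pt s0.
have : nbhs x0 [set x : set_type (range (y a')) | val (g x) i = val (g x0) i].
  apply: (gc x0 [set z | val z i = val (g x0) i]).
  apply: (@initial_continuous _ Dc set_val (g x0) [set z : Dc | z i = _]).
  exact: Dc_nbhs_coordinate.
rewrite nbhsE => -[_ [[B Bo <-] Bx0] Bsub].
have [F hF] := nbhs_Dc_box (open_nbhs_nbhs (conj Bo Bx0)).
have [s [sF si]] := hi F (set_val x0) (~~ y a s0 i).
have [x xE] := pt s.
have /Bsub /= : (set_val @^-1` B) x by apply: hF; rewrite set_valE xE.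
by rewrite (gy _ _ x0E) (gy _ _ xE) si; case: (y a s0 i).
Qed.

(** A coordinate decodes to a self-map [p] of the sites and a point [x], and stores [c p x]. *)
Lemma family_code : exists code :
  ((site -> site) -> two_pow_continuum) -> two_pow_continuum, injective code.
Proof.
have [d dP] := @continuum_onto (site * bool)%type (((0%N, [::]), 0%N), false).
exists (fun c i => c (fun s => (d i (pickle s)).1) (fun n => (d i n).2)).
move=> c c' e; apply/funext => p; apply/funext => x.
have [i di] := dP (fun n => (if unpickle n is Some s then p s else
  ((0%N, [::]), 0%N), x n)).
have := congr1 (@^~ i) e; rewrite di /=.
suff -> : (fun s => if unpickle (pickle s) is Some s' then p s' else
  ((0%N, [::]), 0%N)) = p by [].
by apply/funext => s; rewrite pickleK.
Qed.

Lemma homeomorphic_transversal (y : two_pow_continuum -> site -> Dc) :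
  (forall a a' (g : set_type (range (y a')) -> set_type (range (y a))),
    continuous g -> (forall x s, val x = y a' s -> val (g x) = y a s) ->
    a = a') ->
  exists r : two_pow_continuum -> two_pow_continuum, injective r /\
    forall a b, a <> b ->
      ~ homeomorphic (set_type (range (y (r a)))) (set_type (range (y (r b)))).
Proof.
move=> ylab; pose Y a : topologicalType := set_type (range (y a)).
have hrefl a : homeomorphic (Y a) (Y a).
  by exists id, id; split=> // x; exact: cvg_id.
pose rep a := xget (fun=> false) [set b | homeomorphic (Y a) (Y b)].
have repP a : homeomorphic (Y a) (Y (rep a)).
  exact: (xgetPex (fun=> false)
    (ex_intro [set b | homeomorphic (Y a) (Y b)] a (hrefl a))).
have repE a b : homeomorphic (Y a) (Y b) -> rep a = rep b.
  move=> ab; congr xget; apply/seteqP; split=> c /=.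
    exact: homeomorphic_trans (homeomorphic_sym ab).
  exact: homeomorphic_trans ab.
have /choice[lab labP] a : exists p : site -> site,
    exists (f : Y a -> Y (rep a)) (g : Y (rep a) -> Y a),
    [/\ cancel f g, continuous f, continuous g &
      forall x s, val x = y a s -> val (f x) = y (rep a) (p s)].
  have [f [g [fg _ cf cg]]] := repP a.
  have /choice[p pP] s : exists s', forall x : Y a, val x = y a s ->
      val (f x) = y (rep a) s'.
    pose x0 : Y a := SigSub (mem_set (imageT (y a) s)).
    have [s' _ s'E] := set_mem (valP (f x0)); exists s' => x xE.
    by rewrite s'E; congr (val (f _)); exact: val_inj.
  by exists p, f, g; split=> // x s; exact: pP.
(* Homeomorphisms of [Y a] and [Y b] onto the same representative that induce
   the same map on sites compose to one that sends [y b s] to [y a s]. *)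
have lab_inj a b : homeomorphic (Y a) (Y b) -> lab a = lab b -> a = b.
  move=> /repE ab labE; have [f [g [fg cf cg fy]]] := labP a.
  have [f' [g' [fg' cf' cg' fy']]] := labP b.
  move: f' g' fg' cf' cg' fy'; rewrite -ab -labE => f' g' fg' cf' cg' fy'.
  apply: (ylab a b (g \o f')).
    by move=> x; apply: continuous_comp; [exact: cf'|exact: cg].
  move=> x s xE; pose x0 : Y a := SigSub (mem_set (imageT (y a) s)).
  suff -> : (g \o f') x = x0 by [].
  rewrite /= -(fg x0); congr g; apply: val_inj.
  by rewrite (fy' _ _ xE) (fy x0 s).
have [code code_inj] := family_code.
(* The labels in one fibre of [lab] are pairwise nonhomeomorphic by [lab_inj]; this fibre has a
   member for every [a]. *)
have [p hp] := konig (lab \o code).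
have /choice[c cP] a : exists c, lab (code c) = p /\ c p = a.
  by have [c cp ca] := hp a; exists c.
exists (code \o c); split=> [a b /code_inj e|a b ab h].
  by rewrite -(cP a).2 -(cP b).2 e.
apply: ab; rewrite -(cP a).2 -(cP b).2; congr (_ p); apply: code_inj.
by apply: lab_inj h _; rewrite /= (cP a).1 (cP b).1.
Qed.

(* A set [A] seen as a type, [set_type A], carries the subspace topology. *)
Theorem theorem5 :
  exists Y : two_pow_continuum -> set Dc,
    [/\ forall a : two_pow_continuum, dense (Y a) /\ countable (Y a),
        forall (a : two_pow_continuum) (u : nat -> Dc),
          (forall n : nat, Y a (u n)) ->
          ~ trivial_seq u -> ~ seq_converges u
      & forall a b : two_pow_continuum, a <> b ->
          Y a `&` Y b = set0 /\
          ~ homeomorphic (set_type (Y a)) (set_type (Y b))].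
Proof.
have [y [yd ysplit ydisj ytop]] := exists_points.
have [r [rinj rhomeo]] :=
  homeomorphic_transversal (relabelling_continuous_eq ytop).
exists (fun a => range (y (r a))); split=> [a|a|a b ab].
- split; first exact: dense_range (yd _).
  by apply: (sub_countable (card_image_le _ _)); exact: countableP.
- exact: no_convergent_sequence (ysplit _).
split; last exact: rhomeo.
apply/seteqP; split=> // _ [[s _ <-] [s' _ /ydisj /rinj ba]].
by case: ab.
Qed.
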